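(* Let $p$ be a prime. If $G$ is a $p$-group of nilpotency class $2$ such that $p^2 \leq |G:Z(G)| \leq p^3$, then $\rho_0(G) = 1$.
   Context: A $p$-group means a finite group of order $p^n$ for a prime $p$ and a positive integer $n$. $Z(G)$ is the centre of $G$ and $G'$ its commutator subgroup; $G$ has nilpotency class $2$ if it is nonabelian and $\{1\} < G' \leq Z(G) < G$. A triple $(S,T,U)$ of subgroups of a group $G$ is a subgroup TPP triple of $G$ if for all $s\in S$, $t\in T$, $u\in U$ one has $stu=1 \iff s=t=u=1$. For a finite group $G$ the subgroup TPP ratio is $\rho_0(G) := \max \frac{|S||T||U|}{|G|}$, where the maximum is over all subgroup TPP triples $(S,T,U)$ of $G$. *)

(* Defs.v *)
From HB Require Import structures.
From mathcomp Require Import all_boot all_order all_fingroup all_algebra all_solvable.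

Set Implicit Arguments.
Unset Strict Implicit.
Unset Printing Implicit Defensive.

Import Order.TTheory GRing.Theory Num.Theory GroupScope.

Definition subgroup_TPP (gT : finGroupType) (G S T U : {group gT}) : bool :=
  [&& S \subset G, T \subset G, U \subset G &
    [forall s in S, forall t in T, forall u in U,
      (s * t * u == 1) == [&& s == 1, t == 1 & u == 1]]].

(* The base value 0 does not affect the maximum: every term is nonnegative and
   the range is nonempty (see rho0_attained and rho0_upper_bound). *)
Definition rho0 (gT : finGroupType) (G : {group gT}) : rat :=
  (\big[Num.max/0]_(X : {group gT} * {group gT} * {group gT}
                    | subgroup_TPP G X.1.1 X.1.2 X.2)
     ((#|X.1.1| * #|X.1.2| * #|X.2|)%N%:R / #|G|%:R))%R.

Lemma subgroup_TPPP (gT : finGroupType) (G S T U : {group gT}) :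
  reflect [/\ S \subset G, T \subset G, U \subset G &
            forall s t u, s \in S -> t \in T -> u \in U ->
              (s * t * u = 1 <-> [/\ s = 1, t = 1 & u = 1])]
          (subgroup_TPP G S T U).
Proof.
apply: (iffP and4P) => -[sSG sTG sUG tpp]; split=> //.
- move=> s t u Ss Tt Uu; move/forall_inP/(_ s Ss): tpp.
  move/forall_inP/(_ t Tt)/forall_inP/(_ u Uu)/eqP => E; split.
  + by move/eqP; rewrite E => /and3P[/eqP-> /eqP-> /eqP->].
  + by case=> -> -> ->; rewrite !mulg1.
- apply/forall_inP=> s Ss; apply/forall_inP=> t Tt; apply/forall_inP=> u Uu.
  have [h1 h2] := tpp s t u Ss Tt Uu; apply/eqP; apply/eqP/and3P.
  + by case/h1=> -> -> ->.
  + by case=> /eqP-> /eqP-> /eqP->; rewrite !mulg1.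
Qed.

Lemma rho0_upper_bound (gT : finGroupType) (G S T U : {group gT}) :
  subgroup_TPP G S T U ->
  ((#|S| * #|T| * #|U|)%N%:R / #|G|%:R <= rho0 G)%R.
Proof.
move=> tpp; rewrite /rho0.
exact: (@le_bigmax_cond _ _ _ _ (S, T, U) (fun X => subgroup_TPP G X.1.1 X.1.2 X.2)
  (fun X => (#|X.1.1| * #|X.1.2| * #|X.2|)%N%:R / #|G|%:R)%R).
Qed.

Lemma rho0_attained (gT : finGroupType) (G : {group gT}) :
  exists S T U : {group gT}, subgroup_TPP G S T U /\
    rho0 G = ((#|S| * #|T| * #|U|)%N%:R / #|G|%:R)%R.
Proof.
pose P (X : {group gT} * {group gT} * {group gT}) :=
  subgroup_TPP G X.1.1 X.1.2 X.2.
have P1 : P (1%G, 1%G, 1%G).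
  apply/subgroup_TPPP; rewrite !sub1G; split=> // s t u.
  by move=> /set1P-> /set1P-> /set1P->; rewrite !mulg1.
rewrite /rho0 (@bigmax_eq_arg _ _ _ 0%R _ P _ P1) => [|X _]; last by rewrite divr_ge0 ?ler0n.
case: arg_maxP => // X PX _; by exists X.1.1, X.1.2, X.2.
Qed.

Lemma nil_class_eq2P (gT : finGroupType) (G : {group gT}) :
  nil_class G = 2 <->
  [/\ ~~ abelian G, [1 gT] \proper G^`(1), G^`(1) \subset 'Z(G) & 'Z(G) \proper G].
Proof.
rewrite !properEneq sub1G center_sub !andbT -nil_class2 -nil_class1.
have -> : ([1 gT] != G^`(1)) = ~~ (nil_class G <= 1).
  by rewrite nil_class1 eq_sym (sameP derG1P eqP).
have -> : ('Z(G) != G) = ~~ (nil_class G <= 1).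
  by rewrite nil_class1 (sameP center_idP eqP).
by split=> [-> // | []]; case: (nil_class G) => [|[|[|]]].
Qed.

(* Main.v *)
Require Import Defs.
From HB Require Import structures.
From mathcomp Require Import all_boot all_order all_fingroup all_algebra all_solvable.
From mathcomp Require Import zify.

Set Implicit Arguments.
Unset Strict Implicit.
Unset Printing Implicit Defensive.

Import Order.TTheory GRing.Theory Num.Theory GroupScope.

(** Taking (S, T, U) = (G, 1, 1) gives rho0 G >= 1, so everything lies in the
    inequality |S||T||U| <= |G| for subgroup TPP triples.

    Two facts about triples drive the proof.  If S and T commute elementwise,
    then ST is a subgroup of order |S||T| meeting U trivially, and the
    inequality holds ([subgroup_TPP_cents_leq]).  If K <= S is normal in G, the
    triple remains a TPP triple in G / K, where T and U keep their orders and
    |S| and |G| are both divided by |K|, so the inequality descends from G / K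
    to G ([subgroup_TPP_quotient_leq]).  The TPP is invariant under rotation,
    so S may be replaced with T or U in both.

    Passing to a central quotient preserves G' <= Z(G) and does not increase
    |G : Z(G)|.  Hence, by induction on |G|, the inequality reduces to the case
    where S, T and U all meet Z(G) trivially
    ([subgroup_TPP_TI_center_leq]).  There they are abelian, as G' <= Z(G).
    Write |G : Z(G)| = p^k with k <= 3 and |Z(G)| = p^m; one may assume G
    nonabelian, so that m >= 1.  Since SZ(G) is abelian it is not G, whence
    |S| <= p^(k-1), and likewise for T and U.  If k <= 2 the exponents of
    |S|, |T|, |U| add up to at most 3(k-1) <= k+1 <= k+m.  If k = 3 and at most
    one of the three has order p^2, they add up to at most 4 <= k+m.  Finally,
    if k = 3 and, say, |S| = |T| = p^2, then SZ(G) and TZ(G) are abelian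
    maximal subgroups of G.  Two distinct ones would generate G, so their
    intersection would be central of index p^2, contradicting k = 3; hence
    SZ(G) = TZ(G), and S and T commute. *)

(** * Subgroup triples with the triple product property *)

Lemma subgroup_TPP_rot (gT : finGroupType) (G S T U : {group gT}) :
  subgroup_TPP G S T U -> subgroup_TPP G T U S.
Proof.
move=> /subgroup_TPPP[sSG sTG sUG tpp]; apply/subgroup_TPPP; split=> //.
move=> t u s Tt Uu Ss; split=> [tus1 | [-> -> ->]]; last by rewrite !mulg1.
have stu1: s * t * u = 1.
  by apply: (mulIg s); rewrite mul1g -!mulgA (mulgA t) tus1 mulg1.
by case/(tpp s t u Ss Tt Uu): stu1.
Qed.

Lemma subgroup_TPP_TI (gT : finGroupType) (G S T U : {group gT}) :
  subgroup_TPP G S T U -> S :&: T = 1.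
Proof.
case/subgroup_TPPP=> _ _ _ tpp; apply/trivgP/subsetP=> x /setIP[Sx Tx].
have /(tpp x x^-1 1 Sx): x^-1 \in T by rewrite groupV.
by case/(_ (group1 U)) => + _; rewrite mulgV mulg1 => /(_ erefl)[-> _ _]; rewrite inE.
Qed.

(** Commutation makes ST a subgroup, and the TPP says exactly that every element
    of ST has a unique expression as st and that ST meets U trivially. *)
Lemma subgroup_TPP_cents_leq (gT : finGroupType) (G S T U : {group gT}) :
  subgroup_TPP G S T U -> T \subset 'C(S) -> (#|S| * #|T| * #|U| <= #|G|)%N.
Proof.
move=> tppSTU cST; have tiST := subgroup_TPP_TI tppSTU.
have /= defST := cent_joinEr cST.
have cardST: #|S <*> T| = (#|S| * #|T|)%N by rewrite cent_joinEr // (TI_cardMg tiST).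
case/subgroup_TPPP: tppSTU => sSG sTG sUG tpp.
have tiSTU: S <*> T :&: U = 1.
  apply/trivgP/subsetP=> x /setIP[]; rewrite /= defST => /mulsgP[s t Ss Tt ->] Ust.
  have Uust: (s * t)^-1 \in U by rewrite groupV.
  have [/(_ (mulgV _))[-> -> _] _] := tpp s t _ Ss Tt Uust.
  by rewrite mulg1 inE.
rewrite -cardST -(TI_cardMg tiSTU) subset_leq_card //.
by rewrite mul_subG // join_subG sSG.
Qed.

(** If stu = k lies in K, then k^-1 s is still in S because K <= S, so the TPP of
    G applies to (k^-1 s) t u = 1. *)
Lemma subgroup_TPP_quotient (gT : finGroupType) (G S T U K : {group gT}) :
  K <| G -> K \subset S -> subgroup_TPP G S T U ->
  subgroup_TPP (G / K) (S / K) (T / K) (U / K).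
Proof.
move=> /andP[_ nKG] sKS /subgroup_TPPP[sSG sTG sUG tpp].
apply/subgroup_TPPP; rewrite !quotientS //; split=> // x y w.
case/morphimP=> s Ns Ss ->; case/morphimP=> t Nt Tt ->; case/morphimP=> u Nu Uu ->.
split=> [|[-> -> ->]]; last by rewrite !mulg1.
rewrite -!morphM ?groupM //= => /(coset_idr (groupM (groupM Ns Nt) Nu)) Kstu.
have Ss' : (s * t * u)^-1 * s \in S by rewrite groupM // groupV (subsetP sKS).
have stu1: (s * t * u)^-1 * s * t * u = 1.
  by rewrite -(mulgA _ s) -(mulgA _ (s * t)) mulVg.
case/(tpp _ t u Ss' Tt Uu): stu1 => _ t1 u1.
by move: Kstu; rewrite t1 u1 !mulg1 !morph1 => /coset_id->.
Qed.

(** S meets T and U trivially, hence so does K: only the first factor shrinks in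
    the quotient, and it shrinks by the same factor |K| as G. *)
Lemma subgroup_TPP_quotient_leq (gT : finGroupType) (G S T U K : {group gT}) :
    K <| G -> K \subset S -> subgroup_TPP G S T U ->
    (#|S / K| * #|T / K| * #|U / K| <= #|G / K|)%N ->
  (#|S| * #|T| * #|U| <= #|G|)%N.
Proof.
move=> nsKG sKS tpp; have [sKG nKG] := andP nsKG.
have /subgroup_TPPP[sSG sTG sUG _] := tpp.
have card_TI (X : {group gT}) : X \subset G -> K :&: X = 1 -> #|X / K| = #|X|.
  by move=> sXG tiKX; rewrite -(card_isog (quotient_isog (subset_trans sXG nKG) tiKX)).
have tiKT: K :&: T = 1.
  by apply/trivgP; rewrite -(subgroup_TPP_TI tpp) setSI.
have tiKU: K :&: U = 1.
  apply/trivgP; rewrite -(subgroup_TPP_TI (subgroup_TPP_rot (subgroup_TPP_rot tpp))).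
  by rewrite [U :&: S]setIC setSI.
rewrite (card_TI T) // (card_TI U) // !card_quotient ?(subset_trans sSG) // => le_idx.
by rewrite -(Lagrange sKS) -(Lagrange sKG) -!mulnA leq_mul2l mulnA le_idx orbT.
Qed.

(** * Centre and abelian subgroups *)

Lemma indexg_center_quotient (gT : finGroupType) (G K : {group gT}) :
  K \subset 'Z(G) -> (#|G / K : 'Z(G / K)| <= #|G : 'Z(G)|)%N.
Proof.
move=> sKZ; have [sKG cKG] := subsetIP sKZ.
have nKG: G \subset 'N(K) by rewrite (subset_trans _ (cent_sub K)) // centsC.
rewrite -(index_quotient_eq _ (center_sub G) nKG).
  by rewrite dvdn_leq ?indexgS ?quotient_subcent.
exact: subset_trans (subsetIr _ _) sKZ.
Qed.

Lemma TI_center_abelian (gT : finGroupType) (G S : {group gT}) :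
  G^`(1) \subset 'Z(G) -> S \subset G -> S :&: 'Z(G) = 1 -> abelian S.
Proof.
move=> sG'Z sSG tiSZ; apply/derG1P/trivgP; rewrite -tiSZ subsetI der_sub.
exact: subset_trans (dergS 1 sSG) sG'Z.
Qed.

Lemma abelian_joing_center (gT : finGroupType) (G S : {group gT}) :
  S \subset G -> abelian S -> abelian (S <*> 'Z(G)).
Proof.
move=> sSG abS; rewrite abelianY abS center_abelian /=.
by rewrite centsC (subset_trans sSG) // centsC subsetIr.
Qed.

Lemma card_joing_center (gT : finGroupType) (G S : {group gT}) :
  S \subset G -> S :&: 'Z(G) = 1 -> #|S <*> 'Z(G)| = (#|S| * #|'Z(G)|)%N.
Proof.
move=> sSG tiSZ; rewrite cent_joinEr ?TI_cardMg //.
by rewrite centsC (subset_trans sSG) // centsC subsetIr.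
Qed.

(** Two distinct maximal subgroups of a p-group generate it; when both are abelian
    their intersection, which has index p^2, centralises both and is therefore
    central. *)
Lemma abelian_index_p_eq (p : nat) (gT : finGroupType) (G H L : {group gT}) :
    prime p -> p.-group G -> (p ^ 2 < #|G : 'Z(G)|)%N ->
    H \subset G -> L \subset G -> abelian H -> abelian L ->
    #|G : H| = p -> #|G : L| = p ->
  H :=: L.
Proof.
move=> p_pr pG ltp2 sHG sLG abH abL iH iL.
have maxH: maximal H G by rewrite p_index_maximal ?iH.
have maxL: maximal L G by rewrite p_index_maximal ?iL.
have [sHL | nsHL] := boolP (H \subset L).
  by apply/eqP; rewrite eqEcard sHL -(leq_pmul2r (prime_gt0 p_pr)) -{1}iL -{1}iH !Lagrange ?leqnn.
have defG := mulg_normal_maximal (p_maximal_normal pG maxL) maxL sHG nsHL.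
have sLHZ: L :&: H \subset 'Z(G).
  rewrite subsetI subIset ?sLG //= -defG centM subsetI.
  by rewrite subIset ?[L \subset _]abL //= subIset // [H \subset _]abH orbT.
have sIG : L :&: H \subset G by rewrite subIset ?sLG.
suff: (#|G : 'Z(G)| <= p ^ 2)%N by rewrite leqNgt ltp2.
suff <-: #|G : L :&: H| = (p ^ 2)%N by rewrite dvdn_leq ?indexgS.
have cardLH: (#|L| * #|H| = #|G| * #|L :&: H|)%N by rewrite mul_cardG defG.
apply/eqP; rewrite -(eqn_pmul2l (cardG_gt0 (L :&: H))) Lagrange //.
rewrite -(eqn_pmul2l (cardG_gt0 G)) mulnA -cardLH.
by rewrite -{1}(Lagrange sLG) -(Lagrange sHG) iL iH mulnACA.
Qed.

(** * The order bound for triples *)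

(** The base of the induction: with trivial intersections with the centre the
    three orders are bounded through |G : Z(G)| alone, and the centre contributes
    the extra factor p that the count needs. *)
Lemma subgroup_TPP_TI_center_leq (p : nat) (gT : finGroupType) (G S T U : {group gT}) :
    prime p -> p.-group G -> G^`(1) \subset 'Z(G) ->
    (#|G : 'Z(G)| <= p ^ 3)%N -> subgroup_TPP G S T U ->
    S :&: 'Z(G) = 1 -> T :&: 'Z(G) = 1 -> U :&: 'Z(G) = 1 ->
  (#|S| * #|T| * #|U| <= #|G|)%N.
Proof.
move=> p_pr pG sG'Z leZ tpp tiS tiT tiU.
have [abG | nabG] := boolP (abelian G).
  have /subgroup_TPPP[sSG sTG _ _] := tpp.
  by apply: subgroup_TPP_cents_leq tpp _; apply: sub_abelian_cent2 abG _ _.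
have p_gt1 := prime_gt1 p_pr.
have ltE := ltn_exp2l _ _ p_gt1; have leE := leq_exp2l _ _ p_gt1.
have [k iZ] := p_natP (pnat_dvd (dvdn_indexg G 'Z(G)) pG).
have [m cZ] := p_natP (pgroupS (center_sub G) pG).
have cG : #|G| = (p ^ (m + k))%N by rewrite expnD -cZ -iZ Lagrange ?center_sub.
have m_gt0 : (0 < m)%N.
  rewrite lt0n; apply: contraNneq nabG => m0.
  have /eqP: #|'Z(G)| = 1%N by rewrite cZ m0.
  rewrite -trivg_card1 => /eqP/(trivg_center_pgroup pG) ->.
  exact: abelian1.
have expS (X : {group gT}) : X \subset G -> X :&: 'Z(G) = 1 ->
  exists2 a, #|X| = (p ^ a)%N & (a < k)%N.
- move=> sXG tiX; have [a cX] := p_natP (pgroupS sXG pG); exists a => //.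
  have sXZ : X <*> 'Z(G) \subset G by rewrite join_subG sXG center_sub.
  have abXZ := abelian_joing_center sXG (TI_center_abelian sG'Z sXG tiX).
  have: #|X <*> 'Z(G)| < #|G|.
    by rewrite proper_card // properEneq sXZ andbT; apply: contraNneq nabG => <-.
  by rewrite card_joing_center // cX cZ cG -expnD ltE addnC ltn_add2l.
(* Equality of XZ(G) and YZ(G), two abelian subgroups of index p, puts X and Y
   in a common abelian subgroup. *)
have two_large (X Y W : {group gT}) : subgroup_TPP G X Y W ->
    X :&: 'Z(G) = 1 -> Y :&: 'Z(G) = 1 -> k = 3 ->
    #|X| = (p ^ 2)%N -> #|Y| = (p ^ 2)%N ->
  (#|X| * #|Y| * #|W| <= #|G|)%N.
- move=> tppX tiX tiY k3 cX cY; have /subgroup_TPPP[sXG sYG _ _] := tppX.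
  apply: subgroup_TPP_cents_leq (tppX) _.
  have idx (A : {group gT}) : A \subset G -> A :&: 'Z(G) = 1 -> #|A| = (p ^ 2)%N ->
    #|G : A <*> 'Z(G)| = p.
  + move=> sAG tiA cA; have sAZ : A <*> 'Z(G) \subset G by rewrite join_subG sAG center_sub.
    apply/eqP; rewrite -(eqn_pmul2l (cardG_gt0 (A <*> 'Z(G)))) Lagrange //.
    by rewrite card_joing_center // cA cZ cG k3 -expnD -expnSr addnC.
  have abJ (A : {group gT}) (sAG : A \subset G) (tiA : A :&: 'Z(G) = 1) :=
    abelian_joing_center sAG (TI_center_abelian sG'Z sAG tiA).
  have sJG (A : {group gT}) : A \subset G -> A <*> 'Z(G) \subset G.
    by move=> sAG; rewrite join_subG sAG center_sub.
  have eqXY: X <*> 'Z(G) = Y <*> 'Z(G).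
    apply: (abelian_index_p_eq p_pr pG); rewrite ?sJG ?abJ ?idx //.
    by rewrite iZ k3 ltE.
  apply: sub_abelian_cent2 (abJ X sXG tiX) _ _; last exact: joing_subl.
  by rewrite eqXY joing_subl.
have tpp1 := subgroup_TPP_rot tpp; have tpp2 := subgroup_TPP_rot tpp1.
have /subgroup_TPPP[sSG sTG sUG _] := tpp.
have [a cS lta] := expS S sSG tiS.
have [b cT ltb] := expS T sTG tiT.
have [c cU ltc] := expS U sUG tiU.
have lek : (k <= 3)%N by rewrite -leE -iZ.
have [|ltsum] := leqP (a + b + c) (m + k).
  by rewrite cS cT cU cG -!expnD leE.
have k3 : k = 3 by lia.
have [[a2 b2] | [[b2 c2] | [c2 a2]]] : (a = 2 /\ b = 2) \/ (b = 2 /\ c = 2) \/ (c = 2 /\ a = 2).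
- by lia.
- by apply: two_large; rewrite ?cS ?cT ?a2 ?b2.
- by rewrite -mulnA mulnC; apply: two_large; rewrite ?cT ?cU ?b2 ?c2.
by rewrite mulnC mulnA; apply: two_large; rewrite ?cU ?cS ?a2 ?c2.
Qed.

(** The induction on |G|, dividing by the part of one of the three subgroups that
    is central.  Class 2 is taken in the form G' <= Z(G), which also holds in
    quotients that happen to be abelian, so that the induction applies to them. *)
Lemma subgroup_TPP_leq (p : nat) (gT : finGroupType) (G S T U : {group gT}) :
    prime p -> p.-group G -> G^`(1) \subset 'Z(G) ->
    (#|G : 'Z(G)| <= p ^ 3)%N -> subgroup_TPP G S T U ->
  (#|S| * #|T| * #|U| <= #|G|)%N.
Proof.
move=> p_pr; have [n] := ubnP #|G|.
elim: n gT G S T U => // n IHn gT G S T U leGn pG sG'Z leZ.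
have reduce (X Y W : {group gT}) : subgroup_TPP G X Y W -> X :&: 'Z(G) != 1 ->
  (#|X| * #|Y| * #|W| <= #|G|)%N.
- move=> tpp ntK; pose K := (X :&: 'Z(G))%G.
  have sKZ : K \subset 'Z(G) by apply: subsetIr.
  have nsKG : K <| G := sub_center_normal sKZ.
  apply: (subgroup_TPP_quotient_leq nsKG (subsetIl _ _) tpp).
  apply: IHn (subgroup_TPP_quotient nsKG (subsetIl _ _) tpp).
  + exact: leq_trans (ltn_quotient ntK (normal_sub nsKG)) leGn.
  + exact: quotient_pgroup.
  + rewrite -quotient_der ?normal_norm //.
    exact: subset_trans (quotientS _ sG'Z) (quotient_subcent _ _ _).
  exact: leq_trans (indexg_center_quotient sKZ) leZ.
move=> tpp; have tpp1 := subgroup_TPP_rot tpp; have tpp2 := subgroup_TPP_rot tpp1.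
have [tiS | /(reduce S T U tpp) //] := eqVneq (S :&: 'Z(G)) 1.
have [tiT | /(reduce T U S tpp1)] := eqVneq (T :&: 'Z(G)) 1; last first.
  by rewrite mulnC mulnA.
have [tiU | /(reduce U S T tpp2)] := eqVneq (U :&: 'Z(G)) 1; last first.
  by rewrite -mulnA mulnC.
exact: (subgroup_TPP_TI_center_leq p_pr pG sG'Z leZ tpp tiS tiT tiU).
Qed.

Theorem theorem5p1 (p : nat) (gT : finGroupType) (G : {group gT})
    (p_pr : prime p) (pG : p.-group G) (ntG : G :!=: 1)
    (clG : nil_class G = 2)
    (indexG : (p ^ 2 <= #|G : 'Z(G)| <= p ^ 3)%N) :
  rho0 G = 1%R.
Proof.
have [S [T [U [tpp def_rho]]]] := rho0_attained G.
have G_gt0 : (0 < #|G|%:R :> rat)%R by rewrite ltr0n.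
apply/eqP; rewrite eq_le; apply/andP; split.
  rewrite def_rho ler_pdivrMr // mul1r ler_nat.
  have [_ leZ] := andP indexG.
  by apply: subgroup_TPP_leq p_pr pG _ leZ tpp; rewrite -nil_class2 clG.
have tppG : subgroup_TPP G G 1 1.
  apply/subgroup_TPPP; rewrite subxx sub1G; split=> // s t u _ /set1P-> /set1P->.
  by rewrite !mulg1; split=> [-> | []].
have := rho0_upper_bound tppG.
by rewrite cards1 !muln1 divff // gt_eqF.
Qed.
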